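(* Let $G$ be a simple graph on $n$ vertices, and let $a_0$ be the constant term of the characteristic polynomial $\phi(G;x)=\det(xI-A(G))$ of $G$. Then for any integer $m\ge 2$, $$\det W(G\circ P_m)=\pm a_0^{\lfloor m/2\rfloor}\,(\det W(G))^m,$$ i.e. the left-hand side equals $a_0^{\lfloor m/2\rfloor}(\det W(G))^m$ or its negative.
   Context: For a simple graph $G$ with vertex set $\{1,\ldots,n\}$, $A(G)$ denotes its adjacency matrix (the $n\times n$ symmetric $0/1$ matrix whose $(i,j)$ entry is $1$ if and only if $i$ and $j$ are adjacent). The walk matrix of $G$ is the $n\times n$ matrix $W(G)=[e,Ae,\ldots,A^{n-1}e]$, where $A=A(G)$ and $e$ is the all-ones vector. $P_m$ is the path on $m$ vertices, rooted at one of its endvertices. The rooted product graph $G\circ P_m$ is the graph on $mn$ vertices obtained from $G$ and $n$ disjoint copies of $P_m$ by identifying the root (endvertex) of the $i$-th copy of $P_m$ with the $i$-th vertex of $G$, for $i=1,\ldots,n$. (Relabelling the vertices of a graph only permutes the rows of its walk matrix, so the determinant is well defined up to sign.) *)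

(* Defs.v *)
From HB Require Import structures.
From mathcomp Require Import all_boot all_order all_algebra.
Set Implicit Arguments.
Unset Strict Implicit.
Unset Printing Implicit Defensive.
Import GRing.Theory.
Local Open Scope ring_scope.

Record sgraph (V : finType) := SGraph {
  adj :> rel V;
  adj_sym : symmetric adj;
  adj_irr : irreflexive adj
}.

Definition path_rel (m : nat) : rel 'I_m :=
  fun i j => (i.+1 == j :> nat) || (j.+1 == i :> nat).

Lemma path_rel_sym m : symmetric (@path_rel m).
Proof. by move=> i j; rewrite /path_rel orbC. Qed.

Lemma path_rel_irr m : irreflexive (@path_rel m).
Proof. by move=> i; rewrite /path_rel orbb; apply/negbTE; rewrite neq_ltn ltnSn orbT. Qed.

(* The endvertices are those of value 0 and m.-1. *)
Definition path_graph (m : nat) : sgraph 'I_m :=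
  SGraph (@path_rel_sym m) (@path_rel_irr m).

(* The pair (v, u) is the vertex u of the copy of H attached at v; the vertex
   v of G is identified with the root (v, r) of that copy. *)
Definition rooted_rel (V U : finType) (G : sgraph V) (H : sgraph U) (r : U) :
    rel (V * U) :=
  fun x y => (x.1 == y.1) && H x.2 y.2
             || [&& x.2 == r, y.2 == r & G x.1 y.1].

Lemma rooted_rel_sym (V U : finType) (G : sgraph V) (H : sgraph U) (r : U) :
  symmetric (rooted_rel G H r).
Proof.
move=> x y; rewrite /rooted_rel eq_sym (adj_sym H) (adj_sym G).
by congr (_ || _); rewrite andbCA.
Qed.

Lemma rooted_rel_irr (V U : finType) (G : sgraph V) (H : sgraph U) (r : U) :
  irreflexive (rooted_rel G H r).
Proof. by move=> x; rewrite /rooted_rel (adj_irr H) (adj_irr G) !andbF. Qed.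

Definition rooted_product (V U : finType) (G : sgraph V) (H : sgraph U)
    (r : U) : sgraph (V * U)%type :=
  SGraph (@rooted_rel_sym V U G H r) (@rooted_rel_irr V U G H r).

(* For bijective f, the isomorphic copy of G in which i stands for f i. *)
Definition relabel (V U : finType) (f : U -> V) (G : sgraph V) : sgraph U :=
  @SGraph U (relpre f G) (fun i j => adj_sym G (f i) (f j))
    (fun i => adj_irr G (f i)).

Definition adjmx (n : nat) (G : sgraph 'I_n) : 'M[int]_n :=
  \matrix_(i, j) (G i j)%:R.

Definition walkmx (n : nat) (G : sgraph 'I_n) : 'M[int]_n :=
  \matrix_(i, k) (adjmx G ^+ k *m (const_mx 1 : 'cV_n)) i 0.

(* Main.v *)
Require Import Defs.
From mathcomp Require Import all_boot all_order all_algebra all_fingroup.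
From mathcomp Require Import ring zify.
Import GRing.Theory.
Local Open Scope ring_scope.

(** The determinant of an integer matrix is determined up to sign by the lattice
    that its rows, or its columns, generate ([det_rspan_assoc]), so it suffices to identify the
    lattice generated by the vectors [A'^q 1], where [A'] is the adjacency matrix
    of the rooted product and [1] the all-ones vector, and to exhibit as many
    generators of it with a computable determinant.

    Write the weights on the vertices of the rooted product as [m] by [n]
    matrices, so that the adjacency operator is [B : X |-> P X + E X A], with [A]
    and [P] the adjacency matrices of [G] and of the path and [E] the projection
    on the root. Let [H] be the transpose of the walk matrix of [G]. The claim is
    that the lattice consists of the matrices [D H + G H A] with [D] palindromic,
    that is, invariant under the reversal of the path: modulo [A], the rooted
    product is a union of paths, and the walks from the all-ones vector cannot
    tell a path from its mirror image.

    This lattice is generated by the rows of [palin_mx], which are the rows of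
    [H A] at each of the [m./2] vertices of the first half of the path and the
    rows of [H], symmetrised, at the others. Up to a unimodular factor [palin_mx]
    is block diagonal, so its determinant is, up to sign,
    [(det A)^(m./2) (det H)^m] ([det_palin]); as [a0 = (-1)^n det A], this is the
    formula.

    That the lattice contains all [A'^q 1] is immediate by induction
    ([krylov_sub_palin]). The converse ([palin_sub_krylov]) rests on the
    Chebyshev polynomials [U_j]. If [T] denotes the action of [A], then [U_j(B)]
    moves a row placed at the far end of the path to the vertex at distance [j],
    for [j < m], and
    [U_m(B) = T U_(m-1)(B)] ([cheb_rpath]). Cassini's identity
    [U_m^2 - x U_m U_(m-1) + U_(m-1)^2 = 1] then makes [U_(m-1)(B)] invertible
    over the integers, whence [T] is an integer polynomial in [B]. The all-ones
    vector is the image under [s(B)] of the all-ones row placed at the far end,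
    with [s = U_0 + ... + U_(m-1)], and
    [s (U_m - U_(m-1) + 1) = U_m U_(m-1)] shows that [s(B)] divides [T]
    ([krylov_cheb_sum]). Hence all multiples of [A] are in the lattice; modulo
    these, the walks on the path alone reach every palindromic vector. *)

Set Implicit Arguments.
Unset Strict Implicit.
Unset Printing Implicit Defensive.

(** * Row spans and Krylov matrices over a commutative ring *)

(** The submodule generated by the rows of [K]: combinations with coefficients
    in the ring itself, hence a lattice when the ring is [int]. *)
Definition rspan (R : pzRingType) (k N : nat) (K : 'M[R]_(k, N)) (v : 'rV[R]_N) :=
  exists c : 'rV_k, v = c *m K.

Section RowSpan.
Variables (R : comPzRingType) (k N : nat).
Implicit Types (K : 'M[R]_(k, N)) (v w : 'rV[R]_N).

Lemma rspan0 K : rspan K 0.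
Proof. by exists 0; rewrite mul0mx. Qed.

Lemma rspanD K v w : rspan K v -> rspan K w -> rspan K (v + w).
Proof. by move=> [c ->] [d ->]; exists (c + d); rewrite mulmxDl. Qed.

Lemma rspanZ K a v : rspan K v -> rspan K (a *: v).
Proof. by move=> [c ->]; exists (a *: c); rewrite scalemxAl. Qed.

Lemma rspanB K v w : rspan K v -> rspan K w -> rspan K (v - w).
Proof. by move=> Kv Kw; rewrite -scaleN1r; apply/rspanD/rspanZ. Qed.

Lemma rspan_sum K (I : Type) (r : seq I) (Q : pred I) (F : I -> 'rV_N) :
  (forall i, Q i -> rspan K (F i)) -> rspan K (\sum_(i <- r | Q i) F i).
Proof. by move=> KF; apply: big_ind => //; [apply: rspan0 | move=> *; apply: rspanD]. Qed.

Lemma rspan_row K i : rspan K (row i K).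
Proof. by exists (delta_mx 0 i); rewrite rowE. Qed.

Lemma rspan_rows h (M : 'M[R]_(h, N)) K :
  (forall i, rspan K (row i M)) -> exists Q, M = Q *m K.
Proof.
move=> KM; have /fin_all_exists[c Ec] : forall i, exists c, row i M = c *m K by [].
exists (\matrix_i c i); apply/row_matrixP=> i.
by rewrite row_mul rowK.
Qed.

Lemma rspan_stable K (B : 'M[R]_N) Q v :
  K *m B = Q *m K -> rspan K v -> rspan K (v *m B).
Proof. by move=> KB [c ->]; exists (c *m Q); rewrite -!mulmxA KB. Qed.
End RowSpan.

(** Square integer matrices whose rows generate the same lattice have the same
    determinant up to sign; this includes the singular case. *)
Lemma det_rspan_assoc N (K Y : 'M[int]_N) C C' :
  K = C *m Y -> Y = C' *m K -> \det K = \det Y \/ \det K = - \det Y.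
Proof.
move=> /(congr1 determinant) KY /(congr1 determinant) YK.
rewrite det_mulmx in KY; rewrite det_mulmx in YK.
have : `|\det K|%N == `|\det Y|%N.
  by rewrite eqn_dvd -!dvdzE {1}YK dvdz_mull //= KY dvdz_mull.
by rewrite -eqz_nat !abszE Num.Theory.eqr_norm2 => /orP[] /eqP; [left | right].
Qed.

(** The matrix with rows [v], [v B], ..., [v B^(N-1)]. *)
Definition krylov (R : pzRingType) (N : nat) (B : 'M[R]_N) (v : 'rV[R]_N) : 'M[R]_N :=
  \matrix_k (v *m B ^+ k).

Lemma rspan_krylov (R : comPzRingType) N (B : 'M[R]_N) v : rspan (krylov B v) v.
Proof.
case: N => [|N] in B v *; first by exists 0; rewrite [LHS]thinmx0 [RHS]thinmx0.
by have := rspan_row (krylov B v) ord0; rewrite rowK expr0 mulmx1.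
Qed.

(** By Cayley-Hamilton, [v B^N] is a combination of the lower powers. *)
Lemma krylov_stable (R : comNzRingType) N (B : 'M[R]_N) v :
  exists Q, krylov B v *m B = Q *m krylov B v.
Proof.
case: N => [|N] in B v *; first by exists 0; rewrite [LHS]thinmx0 [RHS]thinmx0.
apply: rspan_rows => k; rewrite row_mul rowK -mulmxA mulmxE -exprSr.
have [ltkN|] := ltnP k.+1 N.+1.
  by have := rspan_row (krylov B v) (Ordinal ltkN); rewrite rowK.
move=> leNk; have -> : k.+1 = N.+1 by apply/eqP; rewrite eqn_leq leNk ltn_ord.
have := Cayley_Hamilton B; rewrite -[char_poly B]coefK poly_def size_char_poly.
rewrite rmorph_sum big_ord_recr /=.
have /eqP -> : (char_poly B)`_N.+1 == 1.
  by have := char_poly_monic B; rewrite monicE lead_coefE size_char_poly.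
rewrite scale1r rmorphXn /= horner_mx_X => /eqP; rewrite addrC addr_eq0 => /eqP->.
rewrite -scaleN1r -scalemxAr mulmx_sumr; apply/rspanZ/rspan_sum => i _.
rewrite linearZ /= rmorphXn /= horner_mx_X -scalemxAr; apply: rspanZ.
by have := rspan_row (krylov B v) i; rewrite rowK.
Qed.

Lemma horner_mx_stable_rows (R : comNzRingType) k N (B : 'M[R]_N.+1)
    (K : 'M[R]_(k, N.+1)) Q p :
  K *m B = Q *m K -> exists Q', K *m horner_mx B p = Q' *m K.
Proof.
move=> KB; elim/poly_ind: p => [|p c [Q' IH]].
  by exists 0; rewrite rmorph0 mulmx0 mul0mx.
exists (Q' *m Q + c%:M); rewrite rmorphD rmorphM /= horner_mx_X horner_mx_C.
by rewrite mulmxDr mulmxDl -mulmxE mulmxA IH -!mulmxA KB mul_scalar_mx mul_mx_scalar.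
Qed.

(** By Cayley-Hamilton again, the inverse of [B] is a polynomial in [B], since
    the constant term of its characteristic polynomial is a unit. *)
Lemma inverse_stable_rows (R : comUnitRingType) k N (B B' : 'M[R]_N)
    (K : 'M[R]_(k, N)) Q :
  B *m B' = 1%:M -> K *m B = Q *m K -> exists Q', K *m B' = Q' *m K.
Proof.
case: N => [|N] in B B' K *.
  by exists 0; rewrite [LHS]thinmx0 [RHS]thinmx0.
move=> BB' KB; have B'B := mulmx1C BB'.
set p := char_poly B; have [Q' KQ'] := horner_mx_stable_rows (drop_poly 1 p) KB.
have Ep : p = drop_poly 1 p * 'X + (p`_0)%:P.
  rewrite -[LHS](poly_take_drop 1) addrC; congr (_ + _).
  by apply/polyP=> -[|i]; rewrite coef_take_poly coefC.
have : p`_0 \is a GRing.unit.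
  rewrite /p char_poly_det unitrMl ?unitrX ?unitrN1 //.
  by have [] := mulmx1_unit BB'.
move=> up0; exists (- (p`_0)^-1 *: Q').
have CH := Cayley_Hamilton B; rewrite -/p Ep rmorphD rmorphM /= horner_mx_X horner_mx_C in CH.
move: CH => /(congr1 (mulmx^~ B')); rewrite mul0mx mulmxDl -mulmxE -mulmxA BB' mulmx1.
move/eqP; rewrite addr_eq0 mul_scalar_mx -scaleNr => /eqP EB'.
by rewrite -scalemxAl -KQ' EB' -scalemxAr scalerA mulrNN mulVr // scale1r.
Qed.

(** * Chebyshev polynomials of a ring element *)

(** The Chebyshev polynomial of the second kind [U_k], rescaled so as to be
    monic and evaluated at [x]: [U_0 = 1], [U_1 = x],
    [U_(k+2) = x U_(k+1) - U_k]. It is the characteristic polynomial of the path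
    on [k] vertices. *)
Fixpoint cheb (R : pzRingType) (x : R) (k : nat) : R :=
  match k with
  | 0 => 1
  | 1 => x
  | (j.+1 as k').+1 => x * cheb x k' - cheb x j
  end.

Lemma chebSS (R : pzRingType) (x : R) k :
  cheb x k.+2 = x * cheb x k.+1 - cheb x k.
Proof. by []. Qed.

Lemma rmorph_cheb (R S : pzRingType) (h : {rmorphism R -> S}) (x : R) k :
  h (cheb x k) = cheb (h x) k.
Proof.
suff [] : h (cheb x k) = cheb (h x) k /\ h (cheb x k.+1) = cheb (h x) k.+1 by [].
elim: k => [|k [IH1 IH2]]; first by rewrite /= rmorph1.
by split=> //; rewrite !chebSS rmorphB rmorphM IH1 IH2.
Qed.

Lemma cheb_comm N (B T : 'M[int]_N) j : T *m B = B *m T ->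
  T *m cheb B j = cheb B j *m T.
Proof.
move=> TB; suff [] : T *m cheb B j = cheb B j *m T /\
   T *m cheb B j.+1 = cheb B j.+1 *m T by [].
elim: j => [|j [IH1 IH2]].
  by split=> //; rewrite /cheb mulmx1 mul1mx.
by split=> //; rewrite chebSS mulmxBr mulmxBl !mulmxE mulrA -!mulmxE TB IH1 -!mulmxA IH2.
Qed.

Lemma cheb_cassini (R : comPzRingType) (x : R) k :
  cheb x k.+1 ^+ 2 - x * cheb x k.+1 * cheb x k + cheb x k ^+ 2 = 1.
Proof.
elim: k => [|k IH]; first by rewrite /=; ring.
rewrite -IH chebSS; ring.
Qed.

Lemma cheb_sum_telescope (R : comPzRingType) (x : R) k :
  (x - 2%:R) * (\sum_(j < k.+1) cheb x j) = cheb x k.+1 - cheb x k - 1.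
Proof.
elim: k => [|k IH]; first by rewrite big_ord1 /=; ring.
rewrite big_ord_recr mulrDr IH chebSS /=; ring.
Qed.

(** [(U_0 + ... + U_k) (U_(k+1) - U_k + 1) = U_(k+1) U_k]; multiplied by [X - 2],
    this is a consequence of the telescoping sum and of Cassini's identity. *)
Lemma cheb_sum_factor k : let U := cheb ('X : {poly int}) in
  (\sum_(j < k.+1) U j) * (U k.+1 - U k + 1) = U k.+1 * U k.
Proof.
move=> U; have := cheb_sum_telescope ('X : {poly int}) k.
have := cheb_cassini ('X : {poly int}) k; rewrite -/U.
set s := \sum_(j < _) _ => cas tel.
have x2 : ('X - 2%:R : {poly int}) != 0.
  by rewrite -polyC_natr polyXsubC_eq0.
apply: (mulfI x2); rewrite mulrA tel.
transitivity (U k.+1 ^+ 2 + U k ^+ 2 - 2%:R * U k.+1 * U k - 1); first ring.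
rewrite -cas; ring.
Qed.

Arguments cheb : simpl never.

(** Let [U_(k+1)(B) = T U_k(B)] with [T] commuting with [B]. Cassini's identity
    becomes [U_k(B)^2 (T^2 - B T + 1) = 1], so [U_k(B)] is invertible, its inverse
    is a polynomial in [B], and so is [T = U_(k+1)(B) U_k(B)^-1]. Moreover
    [cheb_sum_factor] makes [T] a multiple of [U_0(B) + ... + U_k(B)], so the
    Krylov lattice of [v0 (U_0(B) + ... + U_k(B))] contains [v0 T]. *)
Lemma krylov_cheb_sum N (B T : 'M[int]_N) (v0 : 'rV_N) k :
    T *m B = B *m T -> cheb B k.+1 = T *m cheb B k ->
  let K := krylov B (v0 *m \sum_(j < k.+1) cheb B j) in
  (exists Q, K *m T = Q *m K) /\ rspan K (v0 *m T).
Proof.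
case: N => [|N] in B T v0 *.
  move=> _ _ K; split; first by exists 0; rewrite [LHS]thinmx0 [RHS]thinmx0.
  by exists 0; rewrite [LHS]thinmx0 [RHS]thinmx0.
move=> TB uT; set v := v0 *m _ => K.
have [Q KB] : exists Q, K *m B = Q *m K := krylov_stable B v.
have hU j : horner_mx B (cheb 'X j) = cheb B j.
  by rewrite rmorph_cheb /= horner_mx_X.
set u := cheb B k in uT.
have Tu : T * u = u * T.
  rewrite -[u]hU; apply: comm_mx_horner; exact: TB.
have Bu : B * u = u * B by rewrite -[u]hU; apply: comm_mx_horner.
(* [u'] is the inverse of [u], and [T = U_(k+1)(B) u']. *)
pose u' := T * T * u - B * T * u + u.
have uu' : u *m u' = 1%:M.
  have := cheb_cassini ('X : {poly int}) k; have := hU k.+1; have := hU k.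
  rewrite -/u; move: (cheb 'X k) (cheb 'X k.+1) => p0 p1 h0 h1.
  move/(congr1 (horner_mx B)).
  rewrite rmorphD rmorphB !rmorphM [RHS]rmorph1 /= horner_mx_X.
  rewrite h0 h1 uT mulmxE => cas.
  transitivity (1 : 'M[int]_N.+1); last by [].
  rewrite -cas /u' mulrDr mulrBr !mulrA -Tu -Bu.
  by rewrite -[B * u * T]mulrA -Tu !mulrA.
have hstab p : exists Q', K *m horner_mx B p = Q' *m K by apply: horner_mx_stable_rows KB.
have [Qu Ku] := hstab (cheb 'X k).
have [Qu' Ku'] : exists Q', K *m u' = Q' *m K.
  by rewrite hU in Ku; apply: inverse_stable_rows uu' Ku.
have ET : cheb B k.+1 * u' = T.
  by rewrite uT mulmxE -mulrA -mulmxE uu' mulmx1.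
split.
  have [Q1 K1] := hstab (cheb 'X k.+1); rewrite hU in K1.
  by exists (Q1 *m Qu'); rewrite -ET -mulmxE mulmxA K1 -!mulmxA Ku'.
have [Qq Kq] := hstab (cheb 'X k.+1 - cheb 'X k + 1).
have -> : v0 *m T = v *m horner_mx B (cheb 'X k.+1 - cheb 'X k + 1) *m u' *m u'.
  have := congr1 (horner_mx B) (cheb_sum_factor k).
  rewrite rmorphM rmorph_sum /= => E.
  rewrite /v -!mulmxA; congr (_ *m _).
  under eq_bigr do rewrite -hU.
  rewrite mulmxA [_ *m horner_mx _ _]E rmorphM /= !hU -/u -mulmxE -!mulmxA.
  by rewrite [u *m _]mulmxA uu' mul1mx -ET mulmxE.
do 2!apply: (rspan_stable Ku'); apply: (rspan_stable Kq); exact: rspan_krylov.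
Qed.

(** * Determinants of block diagonal and reindexed matrices *)

Lemma det_castmx (R : comPzRingType) N N' (e : N = N') (M : 'M[R]_N) :
  \det (castmx (e, e) M) = \det M.
Proof. by case: N' / e; rewrite castmx_id. Qed.

Lemma det_mxdiag (R : comPzRingType) m (p_ : 'I_m -> nat) (B_ : forall i, 'M[R]_(p_ i)) :
  \det (\mxdiag_i B_ i) = \prod_i \det (B_ i).
Proof.
elim: m => [|m IH] in p_ B_ *.
  move: (\mxdiag_i B_ i); rewrite !big_ord0 => M; exact: det_mx00.
by rewrite mxdiag_recl det_castmx det_ublock IH big_ord_recl.
Qed.

Lemma det_reindex (R : comPzRingType) N N' (g : 'I_N -> 'I_N') (M : 'M[R]_N') :
  bijective g -> \det (\matrix_(i, j) M (g i) (g j)) = \det M.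
Proof.
move=> bg; have eN : N = N' by rewrite -[LHS]card_ord -[RHS]card_ord (bij_eq_card bg).
case: N' / eN in g M bg *.
have -> : \matrix_(i, j) M (g i) (g j) =
   row_perm (perm (bij_inj bg)) (col_perm (perm (bij_inj bg)) M).
  by apply/matrixP=> i j; rewrite !mxE !permE.
rewrite row_permE col_permE !det_mulmx !det_perm odd_permV.
by case: odd_perm; rewrite ?(expr1, mulN1r, mulrN1, opprK) ?(expr0, mul1r, mulr1).
Qed.

Lemma det_row_reindex (R : comPzRingType) N (g : 'I_N -> 'I_N) (M : 'M[R]_N) :
  bijective g -> \det (\matrix_(i, j) M (g i) j) = \det M \/
    \det (\matrix_(i, j) M (g i) j) = - \det M.
Proof.
move=> bg; have -> : \matrix_(i, j) M (g i) j = row_perm (perm (bij_inj bg)) M.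
  by apply/matrixP=> i j; rewrite !mxE !permE.
rewrite row_permE det_mulmx det_perm.
by case: odd_perm; rewrite ?expr1 ?mulN1r ?expr0 ?mul1r; [right | left].
Qed.

(** A linear map that acts on the [i]-th row of a matrix as right multiplication
    by [M_ i] is block diagonal. *)
Lemma det_lin_mx_rows (R : comPzRingType) m n (M_ : 'I_m -> 'M[R]_n)
    (f : {linear 'M[R]_(m, n) -> 'M[R]_(m, n)}) :
  (forall X i, row i (f X) = row i X *m M_ i) ->
  \det (lin_mx f) = \prod_i \det (M_ i).
Proof.
move=> fE.
rewrite -det_mxdiag.
(* [g] matches the indices of the block diagonal matrix with those of [mxvec]. *)
pose g (a : 'I_(\sum_(i < m) n)) := mxvec_index (tagnat.sig1 a) (tagnat.sig2 a).
have inj_g : injective g.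
  pose h (p : 'I_m * 'I_n) : 'I_(\sum_(i < m) n) := @tagnat.Rank m (fun=> n) p.1 p.2.
  move=> a b /cast_ord_inj/enum_rank_inj/(congr1 h).
  by rewrite /h /= !tagnat.sig2K.
have bg : bijective g.
  by apply: inj_card_bij inj_g _; rewrite !card_ord sum_nat_const card_ord.
rewrite -(det_reindex _ bg); congr (\det _); apply/matrixP=> a b.
rewrite [LHS]mxE [RHS]mxE /g; set i := tagnat.sig1 a; set j := tagnat.sig1 b.
set k := tagnat.sig2 a; set l := tagnat.sig2 b.
have -> : lin_mx f (mxvec_index i k) (mxvec_index j l) = row j (f (delta_mx i k)) 0 l.
  by rewrite -[delta_mx i k]mxvecK mxvec_delta -mx_rV_lin -rowE !mxE.
rewrite fE; move: i j k l => i j k l {a b}.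
have [<-|nij] := eqVneq i j.
  by rewrite rowE mul_delta_mx -rowE conform_mx_id mxE.
by rewrite rowE mul_delta_mx_0 1?eq_sym // mul0mx !mxE.
Qed.

(** * The path *)

Lemma adjmx_path_col m (g : nat -> int) :
  adjmx (path_graph m) *m (\col_(j < m) g j) =
  \col_i ((0 < i)%:R * g i.-1 + (i.+1 < m)%:R * g i.+1).
Proof.
apply/colP=> i; rewrite !mxE.
under eq_bigr => j _.
  rewrite !mxE (_ : _%:R * g j = (j.+1 == i)%:R * g j + (i.+1 == j)%:R * g j); last first.
    rewrite -mulrDl -natrD /= /path_rel; congr (_%:R * _); lia.
  over.
rewrite big_split /=; congr (_ + _).
  have [i0|i0] := posnP i.
    by rewrite mul0r big1 // => j _; rewrite i0 mul0r.
  have ltim : (i.-1 < m)%N by have := ltn_ord i; lia.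
  rewrite (bigD1 (Ordinal ltim)) //= prednK // eqxx big1 ?addr0 // => j.
  by rewrite -val_eqE /= => ?; rewrite (_ : _ == _ = false) ?mul0r //; lia.
have [ltim|leim] := ltnP i.+1 m; last first.
  rewrite mul0r big1 // => j _; rewrite (_ : _ == _ = false) ?mul0r //.
  by have := ltn_ord j; lia.
rewrite (bigD1 (Ordinal ltim)) //= eqxx big1 ?addr0 // => j.
by rewrite -val_eqE /= => ?; rewrite (_ : _ == _ = false) ?mul0r //; lia.
Qed.

(** The indicator column of the vertex [u] of the path; it vanishes for [m <= u],
    which lets the recurrences run past the end of the path. *)
Definition basis_col m u : 'cV[int]_m := \col_(j < m) (j == u :> nat)%:R.

(** The indicator column of the vertices [a, ..., m - 1 - a], which is empty
    once [m <= 2 a]. *)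
Definition mid_col m a : 'cV[int]_m := \col_(j < m) (a <= j < m - a)%:R.

Lemma path_basis0 m : adjmx (path_graph m) *m basis_col m 0 = basis_col m 1.
Proof.
rewrite (adjmx_path_col m (fun j => (j == 0)%:R)); apply/colP=> i; rewrite !mxE.
rewrite mulr0 addr0 -natrM mulnb; congr _%:R; lia.
Qed.

Lemma path_basisS m u : (u.+1 < m)%N ->
  adjmx (path_graph m) *m basis_col m u.+1 = basis_col m u + basis_col m u.+2.
Proof.
move=> ltum.
rewrite (adjmx_path_col m (fun j => (j == u.+1)%:R)); apply/colP=> i; rewrite !mxE.
by have := ltn_ord i; rewrite addrC -!natrM -!natrD !mulnb => ltim; congr _%:R; lia.
Qed.

Lemma path_mid0 m : (1 < m)%N ->
  adjmx (path_graph m) *m mid_col m 0 = mid_col m 0 + mid_col m 1.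
Proof.
move=> ltm.
rewrite (adjmx_path_col m (fun j => (0 <= j < m - 0)%:R)); apply/colP=> i.
by have := ltn_ord i; rewrite !mxE -!natrM -!natrD !mulnb => ltim; congr _%:R; lia.
Qed.

(** The bound says that [mid_col m a.+1] has at least two vertices; the identity
    fails when it is a single vertex. *)
Lemma path_midS m a : (a.*2.+3 < m)%N ->
  adjmx (path_graph m) *m mid_col m a.+1 = mid_col m a + mid_col m a.+2.
Proof.
move=> ltam.
rewrite (adjmx_path_col m (fun j => (a.+1 <= j < m - a.+1)%:R)); apply/colP=> i.
by have := ltn_ord i; rewrite !mxE -!natrM -!natrD !mulnb => ltim; congr _%:R; lia.
Qed.

(** * The adjacency operator of the rooted product *)

Section RootedPath.
Variables (n k : nat) (A : 'M[int]_n) (e : 'rV[int]_n).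
Notation m := k.+2.
Notation P := (adjmx (path_graph m)).
Notation E := (delta_mx 0 0 : 'M[int]_m).

(** An integer weight on the vertices of the rooted product is an [m] by [n]
    matrix [X], the weight of the vertex [u] of the copy of the path attached at
    [v] being [X u v]. The adjacency operator is [X |-> P X + E X A], where [P] is
    the adjacency matrix of the path, [E] the projection on the root [0] and [A]
    the (symmetric) adjacency matrix of [G]. [rpath_mx] is its matrix, acting on
    the right of the row vectors [mxvec X]. *)
Definition rpath_mx : 'M[int]_(m * n) :=
  lin_mx (mulmx P \+ (mulmxr A \o mulmx E) : 'M_(m, n) -> 'M_(m, n)).

(** The action of [A] on every row at once, [X |-> X A]. *)
Definition scale_mx : 'M[int]_(m * n) := lin_mx (mulmxr A : 'M_(m, n) -> 'M_(m, n)).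

(** The matrix with all its rows equal to [e]; for [e] the all-ones row, this is
    the all-ones weight. *)
Definition ones_vec : 'rV[int]_(m * n) := mxvec ((const_mx 1 : 'cV_m) *m e).

Lemma mxvec_rpath (X : 'M_(m, n)) :
  mxvec X *m rpath_mx = mxvec (P *m X + E *m X *m A).
Proof. by rewrite mul_vec_lin. Qed.

Lemma mxvec_scale (X : 'M_(m, n)) : mxvec X *m scale_mx = mxvec (X *m A).
Proof. by rewrite mul_vec_lin. Qed.

Lemma scale_rpath_comm : scale_mx *m rpath_mx = rpath_mx *m scale_mx.
Proof.
apply/row_matrixP => i; rewrite !rowE -[delta_mx 0 i]vec_mxK !mulmxA.
rewrite mxvec_scale !mxvec_rpath mxvec_scale mulmxDl.
by congr (mxvec (_ + _)); rewrite ?mulmxA.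
Qed.

Lemma root_basis0 : E *m basis_col m 0 = basis_col m 0.
Proof.
have -> : basis_col m 0 = delta_mx 0 0 by apply/colP=> i; rewrite !mxE andbT.
by rewrite mul_delta_mx.
Qed.

Lemma root_basisS u : E *m basis_col m u.+1 = 0.
Proof.
apply/matrixP=> i j; rewrite !mxE big1 // => l _; rewrite !mxE.
by case: (l =P 0) => [->|_]; rewrite ?mulr0 // andbF mul0r.
Qed.

Lemma basis_col_oversize u : (m <= u)%N -> basis_col m u = 0.
Proof.
move=> lemu; apply/colP=> i; rewrite !mxE (_ : _ == _ = false) //.
by have := ltn_ord i; lia.
Qed.

Lemma rpath_basis0 c :
  mxvec (basis_col m 0 *m c) *m rpath_mx =
    mxvec (basis_col m 1 *m c) + mxvec (basis_col m 0 *m c *m A).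
Proof. by rewrite mxvec_rpath !mulmxA path_basis0 root_basis0 linearD. Qed.

Lemma rpath_basisS c u : (u.+1 < m)%N ->
  mxvec (basis_col m u.+1 *m c) *m rpath_mx =
    mxvec (basis_col m u *m c) + mxvec (basis_col m u.+2 *m c).
Proof.
move=> ltu; rewrite mxvec_rpath !mulmxA path_basisS // root_basisS.
by rewrite !mul0mx addr0 mulmxDl linearD.
Qed.

(** Walking back from the far end [k.+1] of the path, the Chebyshev polynomials
    of the adjacency operator produce the other vertices one by one. *)
Lemma cheb_last_basis c j : (j < m)%N ->
  mxvec (basis_col m k.+1 *m c) *m cheb rpath_mx j = mxvec (basis_col m (k.+1 - j) *m c).
Proof.
have comm i : rpath_mx *m cheb rpath_mx i = cheb rpath_mx i *m rpath_mx.
  exact: cheb_comm.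
suff H : (j < m)%N ->
    mxvec (basis_col m k.+1 *m c) *m cheb rpath_mx j = mxvec (basis_col m (k.+1 - j) *m c) /\
  ((j.+1 < m)%N ->
    mxvec (basis_col m k.+1 *m c) *m cheb rpath_mx j.+1 =
      mxvec (basis_col m (k.+1 - j.+1) *m c)).
  by move=> /H[].
elim: j => [|j IH] ltj.
  split; first by rewrite subn0 mulmx1.
  move=> _; rewrite [cheb _ _]/(rpath_mx) rpath_basisS // (@basis_col_oversize m) //.
  by rewrite mul0mx linear0 addr0 subSS subn0.
have [IH1 /(_ ltj) IH2] := IH (ltnW ltj); split => // ltj2.
rewrite chebSS mulmxBr -mulmxE comm mulmxA IH2 IH1.
have -> : (k.+1 - j.+1 = (k.+1 - j.+2).+1)%N by lia.
rewrite rpath_basisS; last by lia.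
by rewrite (_ : (k.+1 - j = (k.+1 - j.+2).+2)%N) ?addrK //; lia.
Qed.

(** The double subtraction is the shape produced by [cheb_last_basis]. *)
Lemma delta_mx_basis (i : 'I_m) (j : 'I_n) :
  delta_mx i j = basis_col m (k.+1 - (k.+1 - i)) *m delta_mx 0 j :> 'M[int]_(m, n).
Proof.
have -> : (k.+1 - (k.+1 - i))%N = i by have := ltn_ord i; lia.
have -> : basis_col m i = delta_mx i 0.
  by apply/colP=> l; rewrite !mxE andbT.
by rewrite mul_delta_mx.
Qed.

(** One more step from the root: with [B = rpath_mx] and [T = scale_mx],
    [U_m(B) = T U_(m-1)(B)]. It holds on the far ends of the paths, and these
    generate everything under polynomials in [B]. *)
Lemma cheb_rpath : cheb rpath_mx m = scale_mx *m cheb rpath_mx k.+1.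
Proof.
have comm i : rpath_mx *m cheb rpath_mx i = cheb rpath_mx i *m rpath_mx.
  exact: cheb_comm.
have commT i := cheb_comm i scale_rpath_comm.
have last c : mxvec (basis_col m k.+1 *m c) *m cheb rpath_mx m =
   mxvec (basis_col m k.+1 *m c) *m (scale_mx *m cheb rpath_mx k.+1).
  rewrite chebSS mulmxBr -mulmxE comm mulmxA !cheb_last_basis //.
  rewrite commT mulmxA cheb_last_basis //.
  by rewrite subnn subSnn rpath_basis0 addrAC subrr add0r mxvec_scale.
apply/row_matrixP; case/mxvec_indexP=> i j.
rewrite !rowE -mxvec_delta.
rewrite delta_mx_basis -cheb_last_basis; last by lia.
have commU a b : cheb rpath_mx a *m cheb rpath_mx b = cheb rpath_mx b *m cheb rpath_mx a.
  by apply: cheb_comm; rewrite comm.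
rewrite -!mulmxA commU mulmxA last -!mulmxA; congr (_ *m _).
by rewrite [RHS]mulmxA -commT -mulmxA commU.
Qed.

Lemma ones_vec_cheb :
  ones_vec = mxvec (basis_col m k.+1 *m e) *m \sum_(j < k.+2) cheb rpath_mx j.
Proof.
rewrite mulmx_sumr; under eq_bigr => j _ do rewrite cheb_last_basis //.
rewrite -linear_sum -mulmx_suml /ones_vec; congr (mxvec (_ *m _)).
apply/colP=> i; rewrite mxE summxE.
rewrite (bigD1 (rev_ord i)) //= mxE (_ : _ == _ = true) ?big1 ?addr0 // => [j|];
  last by have := ltn_ord i; lia.
rewrite -val_eqE /= mxE => ?; rewrite (_ : _ == _ = false) //.
by have := ltn_ord i; have := ltn_ord j; lia.
Qed.
End RootedPath.

(** * The palindromic lattice *)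

(** A unitriangular matrix. Its row [i] is the indicator of [i] when [i] is in
    the first half of the path, and of [i] together with its mirror image
    otherwise (once for the middle vertex). *)
Definition fold_mx m : 'M[int]_m :=
  \matrix_(i, j) ((j == i) || (m <= i.*2.+1)%N && (j == rev_ord i))%:R.

(** The diagonal projections on the first [m./2] vertices of the path and on
    the others. *)
Definition low_mx m : 'M[int]_m := diag_mx (\row_(i < m) (i.*2.+1 < m)%:R).
Definition high_mx m : 'M[int]_m := diag_mx (\row_(i < m) (m <= i.*2.+1)%:R).

Lemma low_mx_proj m n (X Y : 'M[int]_(m, n)) :
  low_mx m *m (low_mx m *m X + high_mx m *m Y) = low_mx m *m X.
Proof.
rewrite /low_mx /high_mx !mul_diag_mx; apply/matrixP=> i j; rewrite !mxE.
by case: ltnP => _; rewrite ?(mul1r, mul0r, addr0, mulr0).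
Qed.

Lemma high_mx_proj m n (X Y : 'M[int]_(m, n)) :
  high_mx m *m (low_mx m *m X + high_mx m *m Y) = high_mx m *m Y.
Proof.
rewrite /low_mx /high_mx !mul_diag_mx; apply/matrixP=> i j; rewrite !mxE.
by case: ltnP => _; rewrite ?(mul1r, mul0r, add0r, mulr0).
Qed.

Lemma low_mx_basis m (i : 'I_m) :
  low_mx m *m basis_col m i = (i.*2.+1 < m)%:R *: basis_col m i.
Proof.
rewrite mul_diag_mx; apply/matrixP=> j l; rewrite !mxE.
by case: (j =P i :> nat) => [->|]; rewrite ?mulr0.
Qed.

Lemma high_mx_basis m (i : 'I_m) :
  high_mx m *m basis_col m i = (m <= i.*2.+1)%:R *: basis_col m i.
Proof.
rewrite mul_diag_mx; apply/matrixP=> j l; rewrite !mxE.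
by case: (j =P i :> nat) => [->|]; rewrite ?mulr0.
Qed.

Lemma det_fold_mx m : \det (fold_mx m) = 1.
Proof.
rewrite det_trig ?big1 // => [i _|]; first by rewrite mxE eqxx.
apply/is_trig_mxP=> i j ltij; rewrite mxE -!val_eqE /=.
by rewrite (_ : _ || _ = false) //; have := ltn_ord j; lia.
Qed.

Lemma low_high_mx m : low_mx m + high_mx m = 1%:M.
Proof.
rewrite -linearD /=; apply/matrixP=> i j; rewrite !mxE.
by case: ltnP => _; rewrite ?addr0 ?add0r.
Qed.

(** A palindromic matrix is determined by the lower half of its rows. *)
Lemma fold_mx_palindrome m n (D : 'M[int]_(m, n)) :
  (forall i j, D (rev_ord i) j = D i j) -> (fold_mx m)^T *m (high_mx m *m D) = D.
Proof.
move=> Drev; apply/matrixP=> i j; rewrite mul_diag_mx mxE.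
pose h := if (m <= i.*2.+1)%N then i else rev_ord i.
have hE : (h == i :> nat) || (h == rev_ord i :> nat).
  by rewrite /h; case: ifP; rewrite eqxx ?orbT.
have hm : (m <= h.*2.+1)%N.
  by rewrite /h; case: (leqP m i.*2.+1) => //=; have := ltn_ord i; lia.
rewrite (bigD1 h) //= big1 => [|l lNh].
  rewrite addr0 !mxE hm mul1r -!val_eqE /=.
  rewrite (_ : _ || _ = true) ?mul1r; last first.
    by move: hE hm => /=; have := ltn_ord i; lia.
  by rewrite /h; case: ifP.
rewrite !mxE -!val_eqE /= mulrA -natrM mulnb (_ : _ && _ = false) ?mul0r //.
move: lNh hE hm; rewrite -val_eqE /=; have := ltn_ord i; have := ltn_ord l; lia.
Qed.

Lemma fold_mx_low m (i : 'I_m) : (i.*2.+1 < m)%N ->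
  (fold_mx m)^T *m basis_col m i = basis_col m i.
Proof.
move=> lti; apply/colP=> j; rewrite mxE (bigD1 i) //= big1 => [|l].
  by rewrite !mxE leqNgt lti orbF eqxx mulr1 addr0.
by rewrite -val_eqE !mxE => /negPf->; rewrite mulr0.
Qed.

Lemma fold_mx_high m (i : 'I_m) : (m <= i.*2.+1)%N ->
  (fold_mx m)^T *m basis_col m i = mid_col m (m - i.+1) - mid_col m (m - i).
Proof.
move=> lei; apply/colP=> j; rewrite mxE (bigD1 i) //= big1 => [|l].
  rewrite !mxE eqxx lei mulr1 addr0 -!val_eqE /=.
  apply/eqP; rewrite eq_sym subr_eq -natrD; apply/eqP; congr _%:R.
  by have := ltn_ord j; have := ltn_ord i; lia.
by rewrite -val_eqE !mxE => /negPf->; rewrite mulr0.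
Qed.

Section Lattices.
Variables (n k : nat) (A : 'M[int]_n) (e : 'rV[int]_n).
Notation m := k.+2.
Notation P := (adjmx (path_graph m)).
Notation E := (delta_mx 0 0 : 'M[int]_m).
Notation H := (krylov A e).
Notation K := (krylov (rpath_mx k A) (ones_vec k e)).

(** With [H] the Krylov matrix of [A] at [e], the rows of [palin_mx] generate
    the lattice of the matrices [D H + G H A] where the rows of [D] read the same
    from both ends: modulo the multiples of [A], these are the palindromic
    weights. These generators are the rows of [H A] placed at the vertices of
    the first half, and the rows of [H] placed at the other vertices and at
    their mirror images. *)
Definition palin_mx : 'M[int]_(m * n) :=
  lin_mx (mulmx (fold_mx m)^T \o
    ((mulmxr (H *m A) \o mulmx (low_mx m)) \+ (mulmxr H \o mulmx (high_mx m)))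
    : 'M_(m, n) -> 'M_(m, n)).

Lemma path_rev (i j : 'I_m) : P (rev_ord i) (rev_ord j) = P i j.
Proof.
rewrite !mxE /= /path_rel /=; congr _%:R; have := ltn_ord i; have := ltn_ord j; lia.
Qed.

(** The palindromic lattice contains [ones_vec] and is stable under the
    adjacency operator, because [P] commutes with the reversal of the path and
    the term at the root is a multiple of [A]. *)
Lemma krylov_sub_palin : exists C, K = C *m palin_mx.
Proof.
apply: rspan_rows => i; rewrite rowK; move: (nat_of_ord i) => q {i}.
have [Q HA] := krylov_stable A e.
have [c ec] := rspan_krylov A e.
(* [HA] turns a further factor [A] into a change of the coefficients [G]. *)
have [D [G [Drev ->]]] : exists D G : 'M[int]_(m, n),
  (forall i j, D (rev_ord i) j = D i j) /\
  ones_vec k e *m rpath_mx k A ^+ q = mxvec (D *m H + G *m H *m A).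
  elim: q => [|q [D [G [Drev IH]]]].
    exists (const_mx 1 *m c), 0; split; last first.
      by rewrite expr0 mulmx1 /ones_vec !mul0mx addr0 -mulmxA -ec.
    by move=> i j; rewrite !mxE; apply: eq_bigr => l _; rewrite !mxE.
  exists (P *m D), (P *m G + E *m D + E *m G *m Q); split.
    move=> i j; rewrite !mxE (reindex_inj rev_ord_inj) /=.
    by apply: eq_bigr => l _; rewrite path_rev Drev.
  rewrite exprSr -mulmxE mulmxA IH mxvec_rpath; congr mxvec.
  rewrite !(mulmxDr, mulmxDl) !mulmxA -[E *m G *m H *m A]mulmxA HA.
  by rewrite !mulmxA -!addrA; congr (_ + (_ + _)); rewrite addrC.
have uF : (fold_mx m)^T \in unitmx by rewrite unitmxE det_tr det_fold_mx unitr1.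
(* The columns of [G] in the basis given by the rows of [fold_mx]. *)
pose G1 := invmx (fold_mx m)^T *m G.
exists (mxvec (low_mx m *m G1 + high_mx m *m (D + G1 *m Q))).
rewrite mul_vec_lin /= low_mx_proj high_mx_proj; congr mxvec.
rewrite !mulmxDr mulmxDl !mulmxDr -!mulmxA.
have -> : Q *m H = H *m A by rewrite HA.
rewrite !mulmxA -[_ *m high_mx m *m D]mulmxA fold_mx_palindrome //.
rewrite addrCA -!mulmxDl -mulmxDr low_high_mx mulmx1.
by rewrite mulmxV // mul1mx.
Qed.

(** The Krylov lattice is stable under [scale_mx] and contains [e A] at the far
    end of the path, by [krylov_cheb_sum]; the recurrence along the path then
    gives [e A] at every vertex. Since [P mid_a = mid_(a-1) + mid_(a+1)] for
    intervals of at least two vertices, with [mid_(-1)] read as [mid_0], it also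
    contains [e] on every centred interval, starting from [mid_0], the whole
    path. The differences of consecutive intervals are the remaining
    generators. *)
Lemma palin_sub_krylov : exists C, palin_mx = C *m K.
Proof.
have [[Q KA] Kroot] :=
  krylov_cheb_sum (mxvec (basis_col m k.+1 *m e)) (scale_rpath_comm k A) (cheb_rpath k A).
rewrite -ones_vec_cheb in KA Kroot.
have [QB KB] : exists Q', K *m rpath_mx k A = Q' *m K := krylov_stable _ _.
pose inK (X : 'M_(m, n)) := rspan K (mxvec X).
have inA X : inK X -> inK (X *m A) by rewrite /inK -mxvec_scale; apply: rspan_stable KA.
have inB X : inK X -> rspan K (mxvec X *m rpath_mx k A) by apply: rspan_stable KB.
have basisA u : (u < m)%N -> inK (basis_col m u *m e *m A).
  suff basisA_down j : (j < m)%N ->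
      inK (basis_col m (k.+1 - j) *m e *m A) /\ inK (basis_col m (k.+2 - j) *m e *m A).
    move=> ltu; have [] := @basisA_down (k.+1 - u)%N _; first lia.
    by rewrite subKn.
  elim: j => [_|j IH ltj].
    rewrite !subn0 (@basis_col_oversize k k.+2) // !mul0mx /inK linear0.
    by split; [rewrite -mxvec_scale | apply: rspan0].
  have [Kj KSj] := IH (ltnW ltj); split; last by rewrite subSS.
  have := inB _ Kj; rewrite -mulmxA (_ : k.+1 - j = (k.+1 - j.+1).+1)%N; last lia.
  rewrite rpath_basisS; last lia.
  rewrite (_ : (k.+1 - j.+1).+2 = k.+2 - j)%N; last lia.
  move=> Kadd; have := rspanB Kadd KSj.
  rewrite mulmxA -[basis_col m (k.+2 - j) *m e *m A]mulmxA.
  by rewrite mulmxA addrK.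
have midK a : (a.*2 <= m)%N -> inK (mid_col m a *m e).
  suff mid_up b : (b.*2.+2 <= m)%N -> inK (mid_col m b *m e) /\ inK (mid_col m b.+1 *m e).
    case: a => [_|a lea]; first by have [] := @mid_up 0%N isT.
    by have [] := @mid_up a lea.
  have K0 : inK (mid_col m 0 *m e).
    have -> : mid_col m 0 = const_mx 1.
      by apply/colP=> i; rewrite !mxE subn0 ltn_ord.
    exact: rspan_krylov.
  elim: b => [_|b IH ltb].
    split=> //; have := rspanB (inB _ K0) (rspanD K0 (basisA 0%N isT)).
    rewrite mxvec_rpath !mulmxA path_mid0 // -!linearD -linearB /= mulmxDl.
    have -> : E *m mid_col m 0 = basis_col m 0.
      apply/colP=> i; rewrite mxE (bigD1 0) //= big1 => [|l l0].
        by rewrite !mxE eqxx andbT mulr1 addr0.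
      by rewrite !mxE (negPf l0) andbF mul0r.
    rewrite opprD addrA [_ + _ - mid_col m 0 *m e]addrAC.
    by rewrite [_ + mid_col m 1 *m e]addrC addrK addrK.
  have [Kb KSb] : inK (mid_col m b *m e) /\ inK (mid_col m b.+1 *m e) by apply: IH; lia.
  split=> //; have := rspanB (inB _ KSb) Kb.
  rewrite mxvec_rpath !mulmxA path_midS; last lia.
  have -> : E *m mid_col m b.+1 = 0.
    apply/colP=> i; rewrite !mxE big1 // => l _; rewrite !mxE.
    by case: (l =P 0) => [->|_]; rewrite ?mulr0 // andbF mul0r.
  by rewrite !mul0mx addr0 -linearB /= mulmxDl addrC addKr.
have inAn X q : inK X -> inK (X *m A ^+ q).
  move=> KX; elim: q => [|q IH]; first by rewrite expr0 mulmx1.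
  by rewrite exprSr -mulmxE mulmxA; apply: inA.
apply: rspan_rows; case/mxvec_indexP=> i j.
rewrite rowE -mxvec_delta mul_vec_lin /=.
have -> : delta_mx i j = basis_col m i *m delta_mx 0 j :> 'M[int]_(m, n).
  rewrite -(mul_delta_mx (0 : 'I_1)); congr (_ *m _).
  by apply/colP=> l; rewrite !mxE andbT.
have rH : delta_mx 0 j *m H = e *m A ^+ j by rewrite -rowE rowK.
rewrite !mulmxA low_mx_basis high_mx_basis -!scalemxAl -!mulmxA [_ *m (H *m A)]mulmxA rH.
have [lti|lei] := ltnP i.*2.+1 m.
  rewrite scale1r scale0r addr0 mulmxA fold_mx_low //.
  rewrite -mulmxA mulmxE -exprSr exprS -mulmxE !mulmxA.
  exact/inAn/basisA.
rewrite scale1r scale0r add0r mulmxA fold_mx_high // mulmxA.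
apply: inAn; rewrite /inK mulmxBl linearB; apply: rspanB; first by apply: midK; lia.
(* For the middle vertex of an odd path, the inner interval is empty. *)
have [le2|lt2] := leqP (m - i).*2 m; first exact: midK.
have -> : mid_col m (m - i) = 0.
  by apply/colP=> l; rewrite !mxE (_ : (_ && _) = false) //; lia.
by rewrite mul0mx linear0; apply: rspan0.
Qed.

Lemma det_palin :
  \det palin_mx = \det A ^+ m./2 * \det H ^+ m \/
  \det palin_mx = - (\det A ^+ m./2 * \det H ^+ m).
Proof.
pose g : {linear 'M_(m, n) -> 'M_(m, n)} :=
  (mulmxr (H *m A) \o mulmx (low_mx m)) \+ (mulmxr H \o mulmx (high_mx m)).
pose f : {linear 'M_(m, n) -> 'M_(m, n)} := mulmx (fold_mx m)^T.
have -> : palin_mx = lin_mx g *m lin_mx f.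
  apply/row_matrixP=> i; rewrite !rowE mulmxA.
  by rewrite !mul_rV_lin mxvecK.
rewrite det_mulmx.
have -> : \det (lin_mx g) = \det A ^+ m./2 * \det H ^+ m.
  rewrite (@det_lin_mx_rows _ _ _ (fun i => if (i < m./2)%N then H *m A else H)).
    rewrite (eq_bigr (fun i : 'I_m => (if (i < m./2)%N then \det A else 1) * \det H)).
      rewrite big_split /= prodr_const card_ord; congr (_ * _).
      rewrite -big_mkcond /= (big_ord_narrow (_ : m./2 <= m)%N); first by lia.
      by rewrite prodr_const card_ord.
    by move=> i _; case: ifP; rewrite ?det_mulmx ?mul1r // mulrC.
  move=> X i; rewrite /g /= linearD /= !row_mul !row_diag_mx -!scalemxAl -!rowE !mxE.
  have -> : (i < m./2)%N = (i.*2.+1 < m)%N by rewrite /=; lia.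
  by case: ltnP; rewrite scale1r scale0r ?addr0 ?add0r.
have : \det (lin_mx f) \is a GRing.unit.
  have FK : (fold_mx m)^T *m invmx (fold_mx m)^T = 1%:M.
    by rewrite mulmxV // unitmxE det_tr det_fold_mx unitr1.
  have : lin_mx f *m lin_mx (mulmx (invmx (fold_mx m)^T) : 'M_(m, n) -> 'M_(m, n)) = 1%:M.
    apply/row_matrixP=> i; rewrite !rowE mulmxA !mul_rV_lin mxvecK mulmx1.
    by rewrite /f /= mulmxA (mulmx1C FK) mul1mx vec_mxK.
  by case/mulmx1_unit; rewrite unitmxE.
by rewrite qualifE => /orP[] /eqP->; rewrite ?mulr1 ?mulrN1; [left | right].
Qed.
End Lattices.

(** * Walk matrices *)

Lemma tr_adjmx n (G : sgraph 'I_n) : (adjmx G)^T = adjmx G.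
Proof. by apply/matrixP=> i j; rewrite !mxE adj_sym. Qed.

Lemma walkmx_krylov n (G : sgraph 'I_n) :
  walkmx G = (krylov (adjmx G) (const_mx 1))^T.
Proof.
apply/matrixP=> i q; rewrite !mxE; apply: eq_bigr => j _; rewrite !mxE mulrC.
have symq : adjmx G ^+ q = (adjmx G ^+ q)^T.
  move: (nat_of_ord q) => {}q; elim: q => [|q IH]; first by rewrite !expr0 trmx1.
  by rewrite {1}exprSr IH exprS trmx_mul tr_adjmx.
by rewrite [in LHS]symq mxE.
Qed.

(** The two terms do not overlap because [G] has no loop. *)
Lemma rooted_product_sum (n k : nat) (G : sgraph 'I_n) (X : 'M[int]_(k.+2, n)) v u :
  \sum_p (rooted_product G (path_graph k.+2) 0 (v, u) p)%:R * X p.2 p.1 =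
  (adjmx (path_graph k.+2) *m X + delta_mx 0 0 *m X *m adjmx G) u v.
Proof.
pose F (v' : 'I_n) (u' : 'I_k.+2) : int :=
  (v == v')%:R * ((path_graph k.+2 u u')%:R * X u' v') +
  (u' == 0)%:R * ((u == 0)%:R * ((G v v')%:R * X u' v')).
transitivity (\sum_v' \sum_u' F v' u').
  rewrite pair_bigA /=; apply: eq_bigr => -[v' u'] _; rewrite /F /=.
  rewrite !mulrA -!natrM -mulrDl -natrD; congr (_%:R * _).
  rewrite /rooted_rel /= !mulnb; case: (v =P v') => [<-|_] /=.
    by rewrite adj_irr !andbF orbF addn0.
  by rewrite andbA [(u == 0) && _]andbC.
rewrite mxE; under eq_bigr do rewrite big_split.
rewrite big_split /=; congr (_ + _).
  rewrite (bigD1 v) //= [X in _ + X]big1 ?addr0 => [|v' /negPf nv].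
    by rewrite mxE; apply: eq_bigr => u' _; rewrite eqxx mul1r !mxE.
  by rewrite big1 // => u' _; rewrite eq_sym nv mul0r.
rewrite -mulmxA [RHS]mxE [RHS](bigD1 0) //= [X in _ = _ + X]big1 ?addr0
  => [|u' /negPf nu]; last first.
  by rewrite mxE nu andbF mul0r.
rewrite !mxE andbT mulr_sumr; apply: eq_bigr => v' _.
rewrite (bigD1 0) //= big1 ?addr0 => [|u' /negPf nu]; last by rewrite nu mul0r.
by rewrite mul1r !mxE (adj_sym G) [X 0 v' * _]mulrC.
Qed.

Lemma det_walkmx_rooted (n k : nat) (G : sgraph 'I_n)
    (f : 'I_(k.+2 * n) -> 'I_n * 'I_k.+2) : bijective f ->
  let K := krylov (rpath_mx k (adjmx G)) (ones_vec k (const_mx 1)) in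
  let D := \det (walkmx (relabel f (rooted_product G (path_graph k.+2) 0))) in
  D = \det K \/ D = - \det K.
Proof.
move=> bf K; set G' := relabel _ _.
pose g a := mxvec_index (f a).2 (f a).1.
have bg : bijective g.
  apply: injF_bij => a b /cast_ord_inj/enum_rank_inj[e2 e1].
  by apply: (bij_inj bf); rewrite [f a]surjective_pairing e1 e2 -surjective_pairing.
suff -> : walkmx G' = \matrix_(a, q) K^T (g a) q.
  by have := det_row_reindex K^T bg; rewrite det_tr.
apply/matrixP=> a q; rewrite [LHS]mxE 3![RHS]mxE; move: (nat_of_ord q) => {}q.
suff [X [-> XE]] : exists X, ones_vec k (const_mx 1) *m rpath_mx k (adjmx G) ^+ q = mxvec X /\
    forall a, (adjmx G' ^+ q *m (const_mx 1 : 'cV_ _)) a 0 = X (f a).2 (f a).1.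
  by rewrite mxvecE -XE.
elim: q {a} => [|q [X [EX XE]]].
  exists ((const_mx 1 : 'cV_k.+2) *m const_mx 1); split=> [|a]; first by rewrite expr0 mulmx1.
  by rewrite expr0 mul1mx !mxE big_ord1 !mxE mulr1.
exists (adjmx (path_graph k.+2) *m X + delta_mx 0 0 *m X *m adjmx G); split.
  by rewrite exprSr -mulmxE mulmxA EX mxvec_rpath.
move=> a; rewrite exprS -mulmxE -mulmxA mxE -rooted_product_sum -surjective_pairing.
rewrite (reindex f) /=; last exact: onW_bij.
by apply: eq_bigr => b _; rewrite XE mxE.
Qed.

Theorem theorem3 (n m : nat) (G : sgraph 'I_n) (hm : (2 <= m)%N)
    (f : 'I_(m * n) -> 'I_n * 'I_m) (hf : bijective f) :
  let root : 'I_m := Ordinal (ltnW hm) in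
  let a0 : int := (char_poly (adjmx G))`_0 in
  let D : int := \det (walkmx (relabel f (rooted_product G (path_graph m) root))) in
  D = a0 ^+ m./2 * \det (walkmx G) ^+ m \/
  D = - (a0 ^+ m./2 * \det (walkmx G) ^+ m).
Proof.
case: m hm f hf => [|[|k]] // hm f hf root a0 D.
have r0 : root = 0 by apply: val_inj.
have eD := det_walkmx_rooted G hf; rewrite -r0 -/D /= in eD.
have [C KC] := krylov_sub_palin k (adjmx G) (const_mx 1).
have [C' YC] := palin_sub_krylov k (adjmx G) (const_mx 1).
have eK := det_rspan_assoc KC YC.
have eY := det_palin k (adjmx G) (const_mx 1).
rewrite walkmx_krylov det_tr /a0 char_poly_det exprMn exprAC -exprM.
rewrite -signr_odd; case: (odd _); rewrite ?expr1 ?expr0 ?mulN1r ?mul1r ?mulNr ?opprK.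
  by case: eD => ->; case: eK => ->; case: eY => ->; rewrite ?opprK; auto.
by case: eD => ->; case: eK => ->; case: eY => ->; rewrite ?opprK; auto.
Qed.
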